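(* Let $P_n$ be the path on $n$ vertices. The chromatic curling number of $P_n$ is $$cn_{\chi}(P_n)=\begin{cases}\frac{n}{2}, & n \text{ is even},\\ \frac{n+1}{2}, & n\text{ is odd},\end{cases}$$ and its chromatic compound curling number is $$cn^c_{\chi}(P_n)=\begin{cases}\frac{n^2}{4}, & n \text{ is even},\\ \frac{n^2-1}{4}, & n\text{ is odd}.\end{cases}$$
   Context: All graphs are simple, finite, connected and undirected. A proper colouring of a graph $G$ is an assignment of colours to its vertices such that no two adjacent vertices have the same colour; $\chi(G)$ is the minimum number of colours in a proper colouring of $G$, and a chromatic colouring (or $\chi$-colouring) of $G$ is a proper colouring with exactly $\chi(G)$ colours. Let $\{c_1,c_2,\ldots,c_\ell\}$ be a $\chi$-colouring of $G$, and let $\theta(c_i)$ be the number of vertices of $G$ having colour $c_i$. With respect to this colouring, the chromatic curling number of $G$ is $cn_{\chi}(G)=\max\{\theta(c_i):1\le i\le \ell\}$ and the chromatic compound curling number of $G$ is $cn^c_{\chi}(G)=\prod_{i=1}^{\ell}\theta(c_i)$.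
   Formalization: The formula for the chromatic compound curling number is stated only for n > 1, because for n = 1 the single colour class has size 1, so the product is 1, whereas (n^2-1)/4 = 0. *)

(* Defs.v *)
From mathcomp Require Import all_boot.

Set Implicit Arguments.
Unset Strict Implicit.
Unset Printing Implicit Defensive.

Record sgraph := SGraph {
  vertex :> finType;
  adj : rel vertex;
  adj_sym : symmetric adj;
  adj_irr : irreflexive adj;
  adj_connected : forall x y : vertex, connect adj x y
}.

Section Colouring.
Variable G : sgraph.

Definition proper_colouring (k : nat) (f : {ffun G -> 'I_k}) : bool :=
  [forall x : G, forall y : G, adj x y ==> (f x != f y)].

(* All k colours are used: "exactly k colours", rather than at most k. *)
Definition proper_colouring_with (k : nat) (f : {ffun G -> 'I_k}) : bool :=
  proper_colouring f && [forall c : 'I_k, exists x : G, f x == c].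

Definition properly_colourable_with (k : nat) : bool :=
  [exists f : {ffun G -> 'I_k}, proper_colouring_with f].

Lemma ex_properly_colourable_with : exists k, properly_colourable_with k.
Proof.
exists #|G|; apply/existsP; exists [ffun x => enum_rank x].
apply/andP; split.
  apply/forallP=> x; apply/forallP=> y; apply/implyP=> xy.
  rewrite !ffunE (inj_eq enum_rank_inj).
  by apply/eqP=> exy; rewrite exy adj_irr in xy.
by apply/forallP=> c; apply/existsP; exists (enum_val c); rewrite ffunE enum_valK.
Qed.

Definition chi : nat := ex_minn ex_properly_colourable_with.

Definition chromatic_colouring (f : {ffun G -> 'I_chi}) : bool :=
  proper_colouring_with f.

Lemma ex_chromatic_colouring : exists f, chromatic_colouring f.
Proof. by rewrite /chromatic_colouring /chi; case: ex_minnP => m /existsP. Qed.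

Definition theta (k : nat) (f : {ffun G -> 'I_k}) (c : 'I_k) : nat :=
  #|[set x : G | f x == c]|.

Definition chromatic_curling (f : {ffun G -> 'I_chi}) : nat :=
  \max_(c < chi) theta f c.

Definition chromatic_compound_curling (f : {ffun G -> 'I_chi}) : nat :=
  \prod_(c < chi) theta f c.

End Colouring.

Section Path.
Variable n : nat.

Definition path_adj : rel 'I_n := fun i j => (i.+1 == j) || (j.+1 == i).

Lemma path_adj_sym : symmetric path_adj.
Proof. by move=> i j; rewrite /path_adj orbC. Qed.

Lemma path_adj_irr : irreflexive path_adj.
Proof. by move=> i; rewrite /path_adj orbb gtn_eqF. Qed.

Lemma path_adj_connected (i j : 'I_n) : connect path_adj i j.
Proof.
suff up (d : nat) (a b : 'I_n) : a + d = b :> nat -> connect path_adj a b.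
  case/orP: (leq_total i j) => [ij | ji].
    by apply: (up (j - i)); rewrite subnKC.
  by rewrite (sym_connect_sym path_adj_sym) (up (i - j)) ?subnKC.
elim: d b => [|d IHd] b ab.
  by rewrite addn0 in ab; rewrite (val_inj ab) connect0.
have lt_n : a + d < n by apply: leq_trans (ltn_ord b); rewrite -ab addnS ltnW.
apply: connect_trans (IHd (Ordinal lt_n) erefl) (connect1 _).
by rewrite /path_adj /= -addnS ab eqxx.
Qed.

Definition path_graph : sgraph :=
  SGraph path_adj_sym path_adj_irr path_adj_connected.

End Path.

(* Main.v *)
(** A path with at least one edge has chromatic number 2, and in a 2-colouring
    adjacent vertices must alternate. The colour classes are therefore the two
    parity classes of vertices, of sizes [uphalf n] and [n./2]. *)

Require Import Defs.
From mathcomp Require Import all_boot all_order all_algebra.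
From mathcomp Require Import zify ring.

Set Implicit Arguments.
Unset Strict Implicit.
Unset Printing Implicit Defensive.

Import GRing.Theory Num.Theory.
Local Open Scope ring_scope.

Lemma properP (G : sgraph) (k : nat) (f : {ffun G -> 'I_k}) :
  reflect (forall x y : G, adj x y -> f x != f y) (proper_colouring f).
Proof.
apply: (iffP forallP) => [fP x y xy | fP x].
  by have /forallP/(_ y)/implyP := fP x; apply.
by apply/forallP=> y; apply/implyP; apply: fP.
Qed.

(** Vertex [i] gets colour [i] modulo [minn n 2]. The minimum covers the single vertex, which cannot
    use two colours. *)
Lemma path_colourable (n : nat) (hn : (0 < n)%N) :
  properly_colourable_with (path_graph n) (minn n 2).
Proof.
have k_gt0 : (0 < minn n 2)%N by lia.
pose f := [ffun i : path_graph n => Ordinal (ltn_pmod (i : 'I_n) k_gt0)].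
apply/existsP; exists f; apply/andP; split.
  apply/properP=> x y; rewrite /= /path_adj => xy.
  rewrite !ffunE -val_eqE /=.
  have := ltn_ord x; have := ltn_ord y.
  have [n2|n2] := leqP 2 n; last by lia.
  by rewrite !modn2; lia.
apply/forallP=> c; apply/existsP.
have cn : (c < n)%N by have := ltn_ord c; lia.
by exists (Ordinal cn); rewrite ffunE -val_eqE /= modn_small.
Qed.

Lemma chi_path (n : nat) (hn : (0 < n)%N) : chi (path_graph n) = minn n 2.
Proof.
rewrite /chi; case: ex_minnP => m /existsP[f /andP[/properP fP _]] m_min.
apply/eqP; rewrite eqn_leq m_min ?path_colourable //=.
(* The colour of vertex 0 forces [0 < m], which settles [n = 1]; for [2 <= n] the edge from 0 to 1
   excludes [m = 1]. *)
have := ltn_ord (f (Ordinal hn)).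
have [n2|n2] := leqP 2 n; last by lia.
have /eqP f01 : f (Ordinal hn) != f (Ordinal n2) by apply: fP.
case: m f {fP m_min} f01 => [|[|m]] f f01; [by []| |by []].
by case: f01; rewrite !ord1.
Qed.

Lemma ord2_eq_neq (a b c : 'I_2) : a != b -> (b == c) = (a != c).
Proof. by case: a b c => [[|[|]] //= ?] [[|[|]] //= ?] [[|[|]]]. Qed.

(** With two colours every edge flips the colour, so induction along the path applies. *)
Lemma proper2_path (n : nat) (f : {ffun path_graph n -> 'I_2})
    (fP : proper_colouring f) (x0 : 'I_n) (x0E : x0 = 0%N :> nat) (x : 'I_n) :
  (f x == f x0) = ~~ odd x.
Proof.
suff H m (y : 'I_n) : y = m :> nat -> (f y == f x0) = ~~ odd m by exact: H.
elim: m y => [|m IHm] y yE.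
  by have -> : y = x0 by [apply: val_inj; rewrite /= yE x0E]; rewrite eqxx.
have mn : (m < n)%N by have := ltn_ord y; lia.
have /properP/(_ (Ordinal mn) y) := fP; rewrite /= /path_adj /= yE eqxx.
by move=> /(_ isT)/ord2_eq_neq->; rewrite IHm.
Qed.

Lemma card_ord_odd (n : nat) (b : bool) :
  #|[set i : 'I_n | odd i == b]| = if b then n./2 else uphalf n.
Proof.
rewrite -sum1_card big_mkcond /=.
under eq_bigr do rewrite inE.
elim: n => [|n IHn]; first by rewrite big_ord0; case: b.
rewrite big_ord_recr /= IHn; case: b {IHn}; rewrite /= uphalf_half;
  by case: (odd n); rewrite /= ?addn0 ?addn1 ?add1n.
Qed.

(** The colour of vertex 0 fills the even indices and the other colour the odd ones. *)
Lemma theta_path (n : nat) (f : {ffun path_graph n -> 'I_2})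
    (fP : proper_colouring f) (x0 : 'I_n) (x0E : x0 = 0%N :> nat) (c : 'I_2) :
  theta f c = if c == f x0 then uphalf n else n./2.
Proof.
transitivity #|[set i : 'I_n | odd i == (c != f x0)]|; last first.
  by rewrite card_ord_odd; case: (c == f x0).
apply: eq_card => x; rewrite !inE.
have [->|cN] := eqVneq c (f x0); first by rewrite (proper2_path fP) // eqbF_neg.
rewrite eqb_id [LHS]eq_sym (@ord2_eq_neq (f x0)); last by rewrite eq_sym.
by rewrite eq_sym (proper2_path fP) ?negbK.
Qed.

Theorem proposition1 (n : nat) (hn : (0 < n)%N)
    (f : {ffun path_graph n -> 'I_(chi (path_graph n))})
    (hf : chromatic_colouring f) :
  (chromatic_curling f)%:R =
    (if odd n then (n%:R + 1) / 2 else n%:R / 2) :> rat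
  /\ ((1 < n)%N ->
      (chromatic_compound_curling f)%:R =
        (if odd n then (n%:R ^+ 2 - 1) / 4 else n%:R ^+ 2 / 4) :> rat).
Proof.
move: hf; rewrite /chromatic_colouring /chromatic_curling
  /chromatic_compound_curling.
(* [chi] occurs in the type of [f], so it is generalized to [k] before its value is substituted. *)
move: (chi _) (chi_path hn) f => k kE f /andP[fP _].
(* For [n = 1] the only class has size 1, so the product is 1 while the odd formula gives 0; hence
   the guard [1 < n]. *)
have [n2|n2] := leqP 2 n; last first.
  have n1 : n = 1%N by lia.
  subst n k; split=> //.
  rewrite big_ord1 /theta (_ : [set _ | _] = setT); last first.
    by apply/setP=> x; rewrite !inE !ord1 eqxx.
  by rewrite cardsT card_ord.
rewrite (minn_idPr n2) in kE; subst k.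
have thetaE := theta_path fP (erefl : Ordinal hn = 0%N :> nat).
have [maxE prodE] : \max_(c < 2) theta f c = uphalf n /\
    (\prod_(c < 2) theta f c = uphalf n * n./2)%N.
  rewrite !big_ord_recl !big_ord0 !thetaE.
  (* Maximum and product are symmetric, so either colour at vertex 0 gives the same values. *)
  have : (f (Ordinal hn) == ord0) || (f (Ordinal hn) == lift ord0 ord0).
    by case: (f _) => [[|[|]]].
  by case/orP=> /eqP-> /=; rewrite ?maxn0 ?muln1; split; lia.
rewrite maxE prodE natrM.
(* For each parity this leaves identities in [n./2] over the rationals. *)
have nE : n%:R = (odd n)%:R + 2 * n./2%:R :> rat.
  by rewrite -natrM -natrD mul2n odd_double_half.
rewrite uphalf_half natrD nE.
by case: (odd n) => /=; split=> [|_]; field.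
Qed.
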